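(* Let $f\in\mathbb{R}\setminus\mathbb{Z}$ and let $\mathcal{F}_4$ be the family of continuous piecewise linear functions $\mathbb{R}\to\mathbb{R}$ (not necessarily with rational breakpoints). Then $$\{\,\pi\in\mathcal{F}_4 : \pi \text{ is extreme}\,\}=\{\,\pi\in\mathcal{F}_4 : \pi\text{ is a facet}\,\}.$$
   Context: Fix $f\in\mathbb{R}\setminus\mathbb{Z}$. Let $\mathcal{Y}$ be the set of finite-support functions $y\colon\mathbb{R}\to\mathbb{Z}_{\ge 0}$ with $\sum_{r\in\mathbb{R}} r\,y(r)\equiv f \pmod 1$ (i.e. the difference is an integer). A function $\pi\colon\mathbb{R}\to\mathbb{R}$ is a valid function if $\pi\ge 0$ and $\sum_{r\in\mathbb{R}}\pi(r)y(r)\ge 1$ for all $y\in\mathcal{Y}$. For a valid function $\pi$, let $P(\pi)=\{\,y\in\mathcal{Y} : \sum_{r}\pi(r)y(r)=1\,\}$. A valid function $\pi$ is extreme if whenever $\pi=\tfrac12(\pi^1+\pi^2)$ with $\pi^1,\pi^2$ valid functions, then $\pi=\pi^1=\pi^2$. A valid function $\pi$ is a facet if for every valid function $\pi'$ with $P(\pi)\subseteq P(\pi')$ we have $\pi'=\pi$. A function is piecewise linear if there is a locally finite collection of closed proper intervals (nonempty, not a single point) covering $\mathbb{R}$, any two distinct ones intersecting at most in a common endpoint, such that the function is affine on the interior of each interval. Locally finite means that every compact interval meets only finitely many members. The endpoints of the intervals are the breakpoints. *)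

(* Defs.v *)
From mathcomp Require Import all_boot all_order all_algebra.
From mathcomp Require Import all_classical all_reals all_analysis.

Set Implicit Arguments.
Unset Strict Implicit.
Unset Printing Implicit Defensive.

Import Order.TTheory GRing.Theory Num.Theory.
Import numFieldNormedType.Exports.

Local Open Scope classical_set_scope.
Local Open Scope ring_scope.

(* A finitely supported sum over the real line: [\sum_(_ \in _) _] ranges over
   the support of the summand, which is finite as soon as that of [y] is. *)
Definition weighted_sum (R : realType) (w : R -> R) (y : R -> nat) : R :=
  \sum_(r \in [set: R]) w r * (y r)%:R.

Definition feasible (R : realType) (f : R) : set (R -> nat) :=
  [set y | finite_set [set r | y r != 0%N] /\
           weighted_sum (fun r => r) y - f \is a Num.int].

Definition valid (R : realType) (f : R) (pi : R -> R) : Prop :=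
  (forall r, 0 <= pi r) /\
  (forall y, feasible f y -> 1 <= weighted_sum pi y).

(* The set P(pi). *)
Definition tight (R : realType) (f : R) (pi : R -> R) : set (R -> nat) :=
  [set y | feasible f y /\ weighted_sum pi y = 1].

Definition extreme (R : realType) (f : R) (pi : R -> R) : Prop :=
  valid f pi /\
  forall pi1 pi2 : R -> R, valid f pi1 -> valid f pi2 ->
    (forall r, pi r = 2^-1 * (pi1 r + pi2 r)) -> pi = pi1 /\ pi = pi2.

Definition facet (R : realType) (f : R) (pi : R -> R) : Prop :=
  valid f pi /\
  forall pi' : R -> R, valid f pi' -> tight f pi `<=` tight f pi' -> pi' = pi.

(* Unbounded closed intervals are allowed. *)
Definition closed_proper_interval (R : realType) (I : set R) : Prop :=
  [/\ is_interval I, closed I & exists x y, [/\ I x, I y & x != y]].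

Definition endpoint (R : realType) (I : set R) (x : R) : Prop :=
  I x /\ (lbound I x \/ ubound I x).

Definition locally_finite_intervals (R : realType) (C : set (set R)) : Prop :=
  forall a b : R, finite_set [set I | C I /\ I `&` `[a, b] !=set0].

Definition piecewise_linear (R : realType) (pi : R -> R) : Prop :=
  exists C : set (set R),
    [/\ C `<=` @closed_proper_interval R,
        locally_finite_intervals C,
        \bigcup_(I in C) I = [set: R],
        (forall I J, C I -> C J -> I <> J ->
           I `&` J = set0 \/
           exists x, [/\ endpoint I x, endpoint J x & I `&` J = [set x]]) &
        (forall I, C I ->
           exists a b : R, forall x, (I°) x -> pi x = a * x + b)].

Definition continuous_piecewise_linear (R : realType) : set (R -> R) :=
  [set pi | continuous pi /\ piecewise_linear pi].

(* Main.v *)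
Require Import Defs.
From mathcomp Require Import all_boot all_order all_algebra.
From mathcomp Require Import all_classical all_reals all_analysis.
From mathcomp Require Import ring lra.

Set Implicit Arguments.
Unset Strict Implicit.
Unset Printing Implicit Defensive.

Import Order.TTheory GRing.Theory Num.Theory.
Import numFieldNormedType.Exports.

Local Open Scope classical_set_scope.
Local Open Scope ring_scope.

(** A facet is extreme by averaging: if [pi] is the mean of two valid functions,
every [y] that is tight for [pi] is tight for both of them.

For the converse, an extreme function [pi] is subadditive, periodic modulo 1,
zero at 0 and satisfies [pi r + pi (f - r) = 1]: otherwise one of its values
could be lowered, whereas no other valid function lies below an extreme one
([extreme_le_eq]).  Let [pi'] be valid with P([pi]) contained in
P([pi']).  The tight solutions [r, f - r] and [x, y, f - (x + y)] show that
[pi'] has the same properties, and that [pi'] is additive at every pair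
[(x, y)] where [pi] is ([tight_carries]).  Put [d := pi' - pi] and write
[defect g x y] for [g x + g y - g (x + y)].  It suffices to find a constant
[C] with [`|defect d x y| <= C * defect pi x y] everywhere: then
[pi + eps * d] and [pi - eps * d] are valid for a small [eps > 0], and their
mean is [pi], so that [d = 0] by extremality.

Continuity and piecewise linearity of [pi] give this constant
([defect_dominated]).
- Since [pi] is linear on both sides of 0, [pi'] is additive there; being
  bounded it grows at most linearly at 0, and being subadditive it is
  Lipschitz.  So [d] and its defect are Lipschitz.
- Near a pair where [defect pi] is positive the bound is clear.  Near a zero
  of [defect pi] the plane splits into six sectors, according to the signs of
  the increments of [x], [y] and [x + y], on each of which [defect pi] is a
  linear form, nonnegative on the two bounding rays.  Along a ray on which the
  form vanishes the defect of [d] vanishes as well, so that the Lipschitz bound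
  in the other direction controls it ([sector_bound]).
- Compactness of the unit square and periodicity make the constant uniform. *)

(** * Solutions as finite sequences *)

(** Finitely supported functions to [nat] are finite multisets.  Listing their
elements turns [weighted_sum] into a sum over a sequence, so that moving mass
from one real to others becomes plain sequence surgery. *)
Definition multiplicity (T : eqType) (s : seq T) : T -> nat :=
  fun r => count_mem r s.

Lemma finite_support_mult (T : choiceType) (s : seq T) :
  finite_set [set r | multiplicity s r != 0%N].
Proof.
apply: (sub_finite_set _ (finite_seq s)) => r /=.
by rewrite /multiplicity -lt0n -has_count has_pred1.
Qed.

Lemma finite_supportP (T : choiceType) (y : T -> nat) :
  finite_set [set r | y r != 0%N] -> exists s, y = multiplicity s.
Proof.
move=> /finite_seqP[l' l'E].
pose l := undup l'.
have lE r : (r \in l) = (y r != 0%N).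
  rewrite mem_undup; apply/idP/idP => h.
    by have : [set` l'] r by []; rewrite -l'E.
  by have : [set r | y r != 0%N] r by []; rewrite l'E.
exists (flatten [seq nseq (y r) r | r <- l]).
apply/funext => r; rewrite /multiplicity count_flatten -map_comp sumnE big_map.
under eq_bigr do rewrite /= count_nseq /=.
have [rl|rl] := boolP (r \in l).
  rewrite (bigD1_seq r) ?undup_uniq //= eqxx mul1n big1 ?addn0 // => i.
  by move=> /negPf ->.
rewrite big_seq big1 => [|i il].
  by move: rl; rewrite lE negbK => /eqP.
by case: eqP => [ir|//]; rewrite -ir il in rl.
Qed.

Lemma weighted_sum_mult (R : realType) (w : R -> R) (s : seq R) :
  weighted_sum w (multiplicity s) = \sum_(r <- s) w r.
Proof.
rewrite /weighted_sum -(@big_undup_iterop_count _ _ _ _ s xpredT w).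
rewrite -(@fsbig_fwiden _ _ _ _ (undup s) [set` s]) ?undup_uniq //.
- rewrite -[in RHS](setTI [set` s]) fsbig_mkcondr.
  apply: eq_fsbigr => r _; rewrite mem_setE; case: ifPn => rs.
    exact: mulr_natr.
  by rewrite /multiplicity (count_memPn rs) mulr0.
- by move=> r /=; rewrite mem_undup.
- by move=> r [/=]; rewrite mem_undup.
Qed.

Definition represents (R : realType) (s : seq R) (a : R) : Prop :=
  \sum_(r <- s) r - a \is a Num.int.

Lemma feasible_mult (R : realType) (f : R) (s : seq R) :
  feasible f (multiplicity s) <-> represents s f.
Proof.
rewrite /feasible /= weighted_sum_mult /represents.
by split => [[]//|]; split => //; exact: finite_support_mult.
Qed.

Lemma validP (R : realType) (f : R) (pi : R -> R) :
  valid f pi <-> (forall r, 0 <= pi r) /\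
    (forall s, represents s f -> 1 <= \sum_(r <- s) pi r).
Proof.
split=> -[pi0 h]; split=> //.
  by move=> s /feasible_mult /h; rewrite weighted_sum_mult.
move=> y fy; have [s ys] := finite_supportP fy.1.
by move: fy; rewrite ys weighted_sum_mult => /feasible_mult /h.
Qed.

Lemma tight_subsetP (R : realType) (f : R) (pi pi' : R -> R) :
  tight f pi `<=` tight f pi' <->
  (forall s, represents s f -> \sum_(r <- s) pi r = 1 ->
     \sum_(r <- s) pi' r = 1).
Proof.
split=> h.
  move=> s fs pis; have [] := h (multiplicity s); rewrite ?weighted_sum_mult //.
  by split; [exact/feasible_mult | rewrite weighted_sum_mult].
move=> y [fy]; have [s ys] := finite_supportP fy.1.
move: fy; rewrite ys weighted_sum_mult => fs pis; split => //.
by rewrite weighted_sum_mult h //; exact/feasible_mult.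
Qed.

(** * Facets are extreme *)

Lemma facet_extreme (R : realType) (f : R) (pi : R -> R) :
  facet f pi -> extreme f pi.
Proof.
move=> [vpi facetpi]; split=> // pi1 pi2 v1 v2 piE.
have sumE s : \sum_(r <- s) pi r =
    2^-1 * (\sum_(r <- s) pi1 r + \sum_(r <- s) pi2 r).
  by rewrite -big_split /= mulr_sumr; apply: eq_bigr.
have [_ w1] := (validP f pi1).1 v1; have [_ w2] := (validP f pi2).1 v2.
split; apply/esym/facetpi => //; apply/tight_subsetP => s sf;
  by rewrite sumE; have := w1 s sf; have := w2 s sf; lra.
Qed.

(** * Extreme functions are minimal *)

(** If [pi' <= pi] is valid, then so is the reflection [2 * pi - pi' >= pi], and
[pi] is the mean of the two. *)
Lemma extreme_le_eq (R : realType) (f : R) (pi pi' : R -> R) :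
  extreme f pi -> valid f pi' -> (forall r, pi' r <= pi r) -> pi' = pi.
Proof.
move=> [vpi ext] vpi' le; have [pi0 _] := vpi.
suff vrefl : valid f (fun r => 2 * pi r - pi' r).
  by have [|<-] := ext _ _ vpi' vrefl; first by move=> r; field.
have /validP[_ {}vpi] := vpi.
apply/validP; split=> [r|s /vpi les]; first by have := pi0 r; have := le r; lra.
by apply: le_trans les _; apply: ler_sum => r _; have := le r; lra.
Qed.

(** A single condition that contains subadditivity, periodicity modulo 1 and
[pi 0 <= 0]: take [s] to be a pair, a singleton or empty. *)
Definition subadditive_mod1 (R : realType) (pi : R -> R) : Prop :=
  forall s a, represents s a -> pi a <= \sum_(r <- s) pi r.

Lemma representsxx (R : realType) (a : R) : represents [:: a] a.
Proof. by rewrite /represents big_seq1 subrr rpred0. Qed.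

Lemma represents_flatten (R : realType) (g : R -> seq R) (s : seq R) (a : R) :
  (forall r, represents (g r) r) -> represents s a ->
  represents (flatten (map g s)) a.
Proof.
move=> grep srep; rewrite /represents big_flatten big_map /=.
have -> : forall u v : R, u - v = (u - \sum_(r <- s) r) + (\sum_(r <- s) r - v).
  by move=> u v; ring.
rewrite rpredD // -sumrB rpred_sum // => r _; exact: grep.
Qed.

(** Were [pi a] larger than the sum over [s0], lowering [pi a] to that sum would
keep [pi] valid: in any solution every [a] can be replaced by [s0]. *)
Lemma extreme_subadditive (R : realType) (f : R) (pi : R -> R) :
  extreme f pi -> subadditive_mod1 pi.
Proof.
move=> ext s0 a rep0; rewrite leNgt; apply/negP => lt.
pose g r := if r == a then s0 else [:: r].
have grep r : represents (g r) r.
  by rewrite /g; case: eqP => [->|_] //; exact: representsxx.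
have [/validP[pi0 vpi] _] := ext.
have E : (fun r => \sum_(t <- g r) pi t) = pi.
  apply: (extreme_le_eq ext) => [|r]; last first.
    by rewrite /g; case: eqP => [->|_]; [exact: ltW | rewrite big_seq1].
  apply/validP; split=> [r|s srep]; first exact: sumr_ge0.
  rewrite -(big_map g xpredT (fun l => \sum_(t <- l) pi t)) -big_flatten.
  by apply: vpi; exact: represents_flatten.
by move: lt; rewrite -[X in _ < X](congr1 (fun h => h a) E) /g eqxx ltxx.
Qed.

(** Validity gives [pi r + pi (f - r) >= 1].  Were this sum [M] larger than 1,
[pi r] could be divided by [M]: the rest of a solution through [r] costs at
least [pi (f - r)] by subadditivity, so that its total was at least [M]. *)
Lemma extreme_symmetric (R : realType) (f : R) (pi : R -> R) :
  extreme f pi -> forall r, pi r + pi (f - r) = 1.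
Proof.
move=> ext; have sub := extreme_subadditive ext.
have [/validP[pi0 vpi] _] := ext.
have rep2 r : represents [:: r; f - r] f.
  by rewrite /represents big_cons big_seq1 (_ : _ - f = 0) ?rpred0 //; ring.
have ge1 r : 1 <= pi r + pi (f - r).
  by have := vpi _ (rep2 r); rewrite big_cons big_seq1.
suff le1 r : 0 < pi r -> pi r + pi (f - r) <= 1.
  move=> r; apply/le_anti; rewrite ge1 andbT.
  have [|/le1//] := leP (pi r) 0; move=> pr.
  have fr : f - (f - r) = r by ring.
  by rewrite -[X in pi X + _]fr addrC le1 //; have := ge1 r; lra.
move=> pr; rewrite leNgt; apply/negP => lt.
set M := pi r + pi (f - r) in lt.
have M0 : 0 < M by lra.
pose pi' t := if t == r then M^-1 * pi r else pi t.
have Mpi t : pi t <= M * pi' t.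
  rewrite /pi'; case: eqP => [->|_]; first by rewrite mulVKf ?gt_eqF.
  by rewrite ler_peMl // ltW.
have lt' : M^-1 * pi r < pi r by rewrite gtr_pMl // invf_lt1.
have : pi' = pi.
  apply: (extreme_le_eq ext) => [|t]; last first.
    by rewrite /pi'; case: eqP => [->|//]; exact: ltW.
  apply/validP; split=> [t|s srep].
    by rewrite /pi'; case: ifP => // _; rewrite mulr_ge0 ?invr_ge0 ?ltW.
  have [rs|rs] := boolP (r \in s); last first.
    rewrite big_seq (eq_bigr pi) -?big_seq ?vpi // => t ts.
    by rewrite /pi' ifN //; apply: contraNneq rs => <-.
  rewrite -(ler_pM2l M0) mulr1 mulr_sumr.
  apply: le_trans (ler_sum _ (fun t _ => Mpi t)).
  rewrite (big_rem r) //= lerD2l sub //.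
  move: srep; rewrite /represents (big_rem r) //= => h.
  by rewrite opprB addrA [_ + r]addrC.
move=> /(congr1 (fun h => h r)); rewrite /pi' eqxx => E.
by move: lt'; rewrite E ltxx.
Qed.

(** The Gomory-Johnson description of minimal valid functions. *)
Record minimal_valid (R : realType) (f : R) (pi : R -> R) : Prop :=
  MinimalValid {
    mv_ge0 : forall r, 0 <= pi r;
    mv_0 : pi 0 = 0;
    mv_periodic : forall r k, k \is a Num.int -> pi (r + k) = pi r;
    mv_subadditive : forall x y, pi (x + y) <= pi x + pi y;
    mv_symmetric : forall r, pi r + pi (f - r) = 1 }.

Lemma extreme_minimal_valid (R : realType) (f : R) (pi : R -> R) :
  extreme f pi -> minimal_valid f pi.
Proof.
move=> ext; have sub := extreme_subadditive ext.
have [/validP[pi0 vpi] _] := ext.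
have perle r k : k \is a Num.int -> pi (r + k) <= pi r.
  move=> kint; have := sub [:: r] (r + k); rewrite /represents !big_seq1; apply.
  by rewrite (_ : _ - _ = - k) ?rpredN //; ring.
split=> //.
- apply/le_anti; rewrite pi0 andbT; have := sub [::] 0.
  by rewrite /represents !big_nil subrr rpred0; apply.
- move=> r k kint; apply/le_anti; rewrite perle //=.
  by rewrite -[X in pi X](addrK k) perle // rpredN.
- move=> x y; have := sub [:: x; y] (x + y).
  by rewrite /represents !big_cons !big_nil !addr0 subrr rpred0; apply.
- exact: extreme_symmetric.
Qed.

Lemma minimal_valid_valid (R : realType) (f : R) (pi : R -> R) :
  minimal_valid f pi -> valid f pi.
Proof.
move=> [pi0 pi00 per sub sym]; apply/validP; split=> // s sf.
have suml : pi (\sum_(r <- s) r) <= \sum_(r <- s) pi r.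
  elim: s {sf} => [|r s IH]; first by rewrite !big_nil pi00.
  by rewrite !big_cons (le_trans (sub _ _)) // lerD2l.
apply: le_trans suml; have := sym 0; rewrite pi00 add0r subr0 => <-.
by rewrite -[X in _ <= pi X](subrK f) addrC per.
Qed.

Lemma minimal_valid_le1 (R : realType) (f : R) (pi : R -> R) :
  minimal_valid f pi -> forall r, pi r <= 1.
Proof.
by move=> mpi r; rewrite -(mv_symmetric mpi r) lerDl (mv_ge0 mpi).
Qed.

(** * Functions whose tight set contains that of a minimal function *)

Definition carries_additivity (R : realType) (pi pi' : R -> R) : Prop :=
  forall x y, pi (x + y) = pi x + pi y -> pi' (x + y) = pi' x + pi' y.

(** Every identity comes from a tight solution for [pi]: [r, f - r] for the
symmetry, [f, 0] for [pi' 0 = 0], [r + k, f - r] for periodicity, and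
[x, y, f - (x + y)] for additivity.  The last sequence is a solution in any
case, and with the symmetry this gives subadditivity of [pi']. *)
Lemma tight_carries (R : realType) (f : R) (pi pi' : R -> R) :
  minimal_valid f pi -> valid f pi' -> tight f pi `<=` tight f pi' ->
  minimal_valid f pi' /\ carries_additivity pi pi'.
Proof.
move=> mpi /validP[pi'0 vpi'] /tight_subsetP sub.
have rep2 x y : x + y - f \is a Num.int -> represents [:: x; y] f.
  by rewrite /represents big_cons big_seq1.
have rep3 x y : represents [:: x; y; f - (x + y)] f.
  rewrite /represents !big_cons big_nil.
  by rewrite (_ : _ - f = 0) ?rpred0 //; ring.
have sym r : pi' r + pi' (f - r) = 1.
  have := sub [:: r; f - r]; rewrite !big_cons !big_nil !addr0; apply.
    by apply: rep2; rewrite (_ : _ - f = 0) ?rpred0 //; ring.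
  exact: mv_symmetric.
split; last first.
  move=> x y add; have := sub _ (rep3 x y).
  rewrite !big_cons !big_nil !addr0 !addrA -add (mv_symmetric mpi).
  by have := sym (x + y); move=> h /(_ erefl); lra.
have pif : pi f = 1.
  by have := mv_symmetric mpi 0; rewrite (mv_0 mpi) subr0 add0r.
split=> //.
- have h1 : pi' f = 1.
    by have := sub _ (representsxx f); rewrite !big_seq1; apply.
  have := sub [:: f; 0]; rewrite !big_cons !big_nil !addr0 h1 pif (mv_0 mpi).
  rewrite addr0 => /(_ _ erefl) h; suff : 1 + pi' 0 = 1 by lra.
  by apply/h/rep2; rewrite addr0 subrr rpred0.
- move=> r k kint; have := sub [:: r + k; f - r].
  rewrite !big_cons !big_nil !addr0 (mv_periodic mpi) // (mv_symmetric mpi).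
  have := sym r; move=> h /(_ _ erefl) h'.
  suff : pi' (r + k) + pi' (f - r) = 1 by lra.
  by apply/h'/rep2; rewrite (_ : _ - f = k) //; ring.
- move=> x y; have := vpi' _ (rep3 x y); rewrite !big_cons big_nil.
  by have := sym (x + y); lra.
Qed.

(** * One-sided linearity of piecewise linear functions *)

(** Only finitely many pieces meet a neighbourhood of [x].  By convexity each of
them contains all points close to [x] on the side [sg], or none of them; as the
pieces cover the line, one contains all.  Continuity extends the affine
expression to [x] itself. *)
Lemma linear_germ (R : realType) (pi : R -> R) (x sg : R) :
  continuous_piecewise_linear pi -> `|sg| = 1 ->
  exists2 e, 0 < e &
    exists c, forall h, 0 <= h <= e -> pi (x + sg * h) = pi x + c * h.
Proof.
move=> [cpi [C [Cint Cfin Ccov _ Caff]]] sg1.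
have sgsg : sg * sg = 1 by rewrite -expr2 -real_normK ?num_real // sg1 expr1n.
have [s sE] := (finite_seqP _).1 (Cfin (x - 1) (x + 1)).
pose covers (I : set R) :=
  exists2 e, 0 < e & forall h, 0 < h < e -> I (x + sg * h).
pose avoids (I : set R) :=
  exists2 e, 0 < e & forall h, 0 < h < e -> ~ I (x + sg * h).
have dich I : C I -> covers I \/ avoids I.
  move=> CI; have [itvI _ _] := Cint _ CI.
  have [?|nav] := pselect (avoids I); [by right | left].
  have meet e : 0 < e -> exists2 h, 0 < h < e & I (x + sg * h).
    move=> e0; apply: contrapT => h; apply: nav; exists e => // t te It.
    by apply: h; exists t.
  have [e /andP[e0 _] Ie] := meet 1 ltr01.
  exists e => // h /andP[h0 he].
  have [t /andP[t0 th] It] := meet _ h0.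
  have : (sg == 1) || (sg == -1).
    by rewrite -eqf_sqr expr2 sgsg expr1n.
  case/orP=> /eqP sgE; move: Ie It; rewrite sgE ?mul1r ?mulN1r => Ie It.
    by apply: itvI It Ie _ _; lra.
  by apply: itvI Ie It _ _; lra.
have [I CI [e e0 Ie]] : exists2 I, C I & covers I.
  apply: contrapT => ncov.
  have avs I : I \in s -> avoids I.
    move=> Is; have : [set` s] I by []; rewrite -sE => -[CI _].
    by have [cI|//] := dich _ CI; case: ncov; exists I.
  have [e e0 esP] : exists2 e, 0 < e &
      forall h, 0 < h < e -> forall I, I \in s -> ~ I (x + sg * h).
    elim: s avs {sE} => [|I s IH] avs; first by exists 1.
    have [|e e0 He] := IH.
      by move=> J Js; apply: avs; rewrite inE Js orbT.
    have [e' e'0 He'] := avs I (mem_head _ _).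
    exists (Num.min e e'); first by rewrite lt_min e0.
    move=> h /andP[h0]; rewrite lt_min => /andP[he he'] J.
    rewrite inE => /orP[/eqP->|]; first by apply: He'; rewrite h0.
    by apply: He; rewrite h0.
  (* A point on the side [sg], within distance 1 of [x], that every piece of the
     list avoids: it lies in no piece at all. *)
  pose h := Num.min (e / 2) 1.
  have h0 : 0 < h by rewrite lt_min ltr01 andbT divr_gt0.
  have he : h < e by rewrite gt_min ltr_pdivrMr // ltr_pMr // ltr1n.
  have h1 : h <= 1 by rewrite ge_min lexx orbT.
  have [I CI Ih] : (\bigcup_(I in C) I) (x + sg * h) by rewrite Ccov.
  apply: (esP h _ I) => //; first by rewrite h0.
  have : [set I | C I /\ I `&` `[x - 1, x + 1] !=set0] I.
    split=> //; exists (x + sg * h); split=> //=.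
    have : `|sg * h| <= 1 by rewrite normrM sg1 mul1r gtr0_norm.
    by rewrite ler_norml in_itv /= => /andP[? ?]; apply/andP; split; lra.
  by rewrite sE.
have [a [b ab]] := Caff _ CI.
have inner h : 0 < h < e -> pi (x + sg * h) = a * (x + sg * h) + b.
  move=> /andP[h0 he]; apply: ab.
  have d0 : 0 < Num.min h (e - h) by rewrite lt_min h0 subr_gt0.
  apply/nbhs_ballP; exists (Num.min h (e - h)) => //= y.
  rewrite /ball /= lt_min => /andP[yl yr].
  have -> : y = x + sg * (sg * (y - x)) by rewrite mulrA sgsg; ring.
  have : `|sg * (y - x) - h| = `|x + sg * h - y|.
    rewrite -[RHS]mul1r -sg1 -normrM distrC; congr `|_|.
    by rewrite -[in LHS](mul1r h) -sgsg; ring.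
  move=> E; rewrite -E in yl yr.
  by apply: Ie; move: yl yr; rewrite !ltr_norml => /andP[? ?] /andP[? ?]; lra.
have px : pi x = a * x + b.
  have l1 : pi (x + sg * h) @[h --> 0^'+] --> pi x.
    apply: cvg_at_right_filter.
    rewrite -[X in _ --> pi X]addr0 -[X in _ --> pi (_ + X)](mulr0 sg).
    apply: (@cvg_comp _ _ _ (fun h => x + sg * h) pi); last exact: cpi.
    by apply: cvgD; [|apply: cvgM]; [exact: cvg_cst.. | exact: cvg_id].
  have l2 : pi (x + sg * h) @[h --> 0^'+] --> a * x + b.
    have : a * (x + sg * h) + b @[h --> 0^'+] --> a * x + b.
      apply: cvg_at_right_filter.
      rewrite -[X in _ --> a * X + _]addr0.
      rewrite -[X in _ --> a * (_ + X) + _](mulr0 sg).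
      apply: cvgD; last exact: cvg_cst.
      apply: cvgM; first exact: cvg_cst.
      by apply: cvgD; [|apply: cvgM]; [exact: cvg_cst.. | exact: cvg_id].
    apply: cvg_trans; apply: near_eq_cvg.
    near=> h; rewrite inner //; apply/andP; split; near: h.
      exact: nbhs_right_gt.
    exact: nbhs_right_lt.
  exact: (cvg_unique _ l1 l2).
exists (e / 2); first exact: divr_gt0.
exists (a * sg) => h /andP[]; rewrite le_eqVlt => /orP[/eqP<- _|h0 he].
  by rewrite !mulr0 !addr0.
rewrite inner ?px; first by ring.
by apply/andP; split => //; lra.
Unshelve. all: by end_near.
Qed.

(** * Lipschitz continuity *)

(** [pi] is linear on the segment from 0 to [sg * e], so that [pi'] is additive
there.  With [n] the integer part of [e / h], the value [n * pi' (sg * h)] is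
at most 1 while [n * h] is at least [e / 2]. *)
Lemma linear_growth (R : realType) (f : R) (pi pi' : R -> R) (sg : R) :
  continuous_piecewise_linear pi -> minimal_valid f pi ->
  minimal_valid f pi' -> carries_additivity pi pi' -> `|sg| = 1 ->
  exists2 K, 0 <= K & forall h, 0 <= h -> pi' (sg * h) <= K * h.
Proof.
move=> plpi mpi mpi' add sg1.
have [e e0 [c lin0]] := linear_germ 0 plpi sg1.
have lin h : 0 <= h <= e -> pi (sg * h) = c * h.
  by move=> /lin0; rewrite (mv_0 mpi) !add0r.
have addn h n : 0 <= h -> n%:R * h <= e ->
    pi' (sg * (n%:R * h)) = n%:R * pi' (sg * h).
  move=> h0; elim: n => [|n IH] le_e.
    by rewrite mul0r mulr0 mul0r (mv_0 mpi').
  have nh0 : 0 <= n%:R * h by rewrite mulr_ge0.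
  rewrite -natr1 !mulrDl !mul1r mulrDr in le_e *.
  rewrite add ?IH //; first by lra.
  by rewrite -mulrDr !lin; [ring | | |]; apply/andP; split; lra.
exists (2 / e); first by rewrite divr_ge0 // ltW.
move=> h; rewrite le_eqVlt => /orP[/eqP <-|h0].
  by rewrite !mulr0 (mv_0 mpi').
have le1 := minimal_valid_le1 mpi'.
have [he|eh] := leP h e; last first.
  by rewrite (le_trans (le1 _)) // mulrAC ler_pdivlMr //; lra.
pose n := Num.truncn (e / h).
have /andP[n1 n2] := truncn_itv (ltW (divr_gt0 e0 h0)).
have n_gt0 : 1 <= n%:R :> R by rewrite ler1n truncn_gt0 ler_pdivlMr // mul1r.
rewrite -/n -natr1 in n1 n2.
have := addn h n (ltW h0); rewrite -ler_pdivlMr // => /(_ n1) E.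
have := le1 (sg * (n%:R * h)); rewrite E => nle1.
have := mv_ge0 mpi' (sg * h).
move: n2 nle1; rewrite ltr_pdivrMr // mulrAC ler_pdivlMr //.
move: (pi' _) (n%:R) n_gt0 => p N N1 eN Np p0.
nra.
Qed.

(** Subadditivity turns the growth bound at 0 into a bound on all increments. *)
Lemma minimal_valid_lipschitz (R : realType) (f : R) (pi pi' : R -> R) :
  continuous_piecewise_linear pi -> minimal_valid f pi ->
  minimal_valid f pi' -> carries_additivity pi pi' ->
  exists2 K, 0 <= K & forall x y, `|pi' x - pi' y| <= K * `|x - y|.
Proof.
move=> plpi mpi mpi' add.
have [K K0 Kp] := linear_growth plpi mpi mpi' add (normr1 R).
have [|K' K'0 Kn] := @linear_growth _ _ _ _ (-1) plpi mpi mpi' add.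
  by rewrite normrN1.
have gr t : pi' t <= (K + K') * `|t|.
  have [t0|t0] := leP 0 t.
    have := Kp t t0; rewrite mul1r => h; apply: le_trans h _.
    by rewrite ger0_norm // ler_wpM2r // lerDl.
  have := Kn (- t); rewrite mulN1r opprK => h; apply: le_trans (h _) _.
    by rewrite oppr_ge0 ltW.
  by rewrite ltr0_norm // ler_wpM2r ?lerDr // oppr_ge0 ltW.
exists (K + K') => [|x y]; first exact: addr_ge0.
have sub := mv_subadditive mpi'.
have := sub y (x - y); have := sub x (y - x); rewrite !subrKC.
have := gr (x - y); have := gr (y - x); rewrite [`|y - x|]distrC.
by rewrite ler_norml => ? ? ? ?; apply/andP; split; lra.
Qed.

(** * Local domination of the defect *)

Definition defect (R : realType) (g : R -> R) (x y : R) : R :=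
  g x + g y - g (x + y).

Lemma defect_lipschitz (R : realType) (g : R -> R) (K : R) :
  (forall x y, `|g x - g y| <= K * `|x - y|) ->
  forall x y u v,
    `|defect g (x + u) (y + v) - defect g x y| <= 2 * K * (`|u| + `|v|).
Proof.
move=> lip x y u v.
have K0 : 0 <= K.
  by have := lip 1 0; rewrite subr0 normr1 mulr1; apply: le_trans.
have addKl (a b : R) : a + b - a = b by ring.
have := lip (x + u) x; have := lip (y + v) y; rewrite !addKl.
have := lip (x + u + (y + v)) (x + y).
rewrite (_ : x + u + (y + v) - (x + y) = u + v); last by ring.
move=> h1 h2 h3; have h4 := ler_wpM2l K0 (ler_normD u v).
move: h1 h2 h3; rewrite /defect !ler_norml => /andP[? ?] /andP[? ?] /andP[? ?].
by apply/andP; split; lra.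
Qed.

Definition defect_dominated_near (R : realType) (pi d : R -> R) (x y : R) :=
  exists2 e, 0 < e & exists2 C, 0 <= C &
    forall u v, `|u| <= e -> `|v| <= e ->
      `|defect d (x + u) (y + v)| <= C * defect pi (x + u) (y + v).

Lemma defect_dominated_near_positive (R : realType) (pi d : R -> R)
    (K x y : R) :
  (forall x y, `|pi x - pi y| <= K * `|x - y|) ->
  (forall x y, `|d x - d y| <= K * `|x - y|) ->
  0 < defect pi x y -> defect_dominated_near pi d x y.
Proof.
move=> lippi lipd; set m := defect pi x y => m0.
have K0 : 0 <= K.
  by have := lipd 1 0; rewrite subr0 normr1 mulr1; apply: le_trans.
have m2 : 0 < m / 2 by exact: divr_gt0.
(* On the square of half-side [e] neither defect moves by more than [m / 2],
   so that [defect pi] is at least [m / 2] there. *)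
pose e := m / (8 * (K + 1)).
have e0 : 0 < e by rewrite divr_gt0 // mulr_gt0 // ltr_wpDl.
have Ke : 4 * K * e <= m / 2.
  by rewrite /e mulrA ler_pdivrMr; [nra | lra].
exists e => //; exists ((`|defect d x y| + m / 2) / (m / 2)).
  by rewrite divr_ge0 ?addr_ge0 ?(ltW m2).
move=> u v ue ve.
have Kuv : 2 * K * (`|u| + `|v|) <= m / 2.
  apply: le_trans Ke; have -> : 4 * K * e = 2 * K * (e + e) by ring.
  by rewrite ler_wpM2l ?mulr_ge0 // lerD.
have := le_trans (defect_lipschitz lippi x y u v) Kuv.
rewrite -/m ler_norml => /andP[hpi _].
have hd := le_trans (defect_lipschitz lipd x y u v) Kuv.
apply: (@le_trans _ _ (`|defect d x y| + m / 2)).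
  rewrite -[X in `|X|](subrK (defect d x y)) addrC.
  by apply: le_trans (ler_normD _ _) _; rewrite lerD2l.
rewrite -mulrA ler_peMr ?addr_ge0 ?(ltW m2) //.
by rewrite mulrC ler_pdivlMr // mul1r; lra.
Qed.

(** [g] is a linear form on a sector, in coordinates [a], [b] along its two
bounding rays, and [d] is Lipschitz and vanishes with [g].  If [al = 0] then
[d] vanishes on the ray [b = 0], so that [L * b] bounds it, and symmetrically if
[be = 0]; otherwise the path through the corner gives [L * a + L * b].  With
the convention [0^-1 = 0] the constant [L / al + L / be] serves all cases. *)
Lemma sector_bound (R : realType) (g d : R -> R -> R) (e L al be : R) :
  0 < e -> 0 <= L ->
  (forall a b, 0 <= a <= e -> 0 <= b <= e ->
    [/\ g a b = al * a + be * b, 0 <= g a b, g a b = 0 -> d a b = 0,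
        `|d a b - d a 0| <= L * b & `|d a b - d 0 b| <= L * a]) ->
  exists2 C, 0 <= C &
    forall a b, 0 <= a <= e -> 0 <= b <= e -> `|d a b| <= C * g a b.
Proof.
move=> e0 L0 H.
have z0 : 0 <= (0 : R) <= e by rewrite lexx; exact: ltW.
have ee : 0 <= e <= e by apply/andP; split=> //; exact: ltW.
have al0 : 0 <= al.
  by have [-> + _ _ _] := H _ _ ee z0; rewrite mulr0 addr0 pmulr_lge0.
have be0 : 0 <= be.
  by have [-> + _ _ _] := H _ _ z0 ee; rewrite mulr0 add0r pmulr_lge0.
exists (L / al + L / be); first by rewrite addr_ge0 ?divr_ge0.
move=> a b ha hb; have [gE g0 gd db da] := H _ _ ha hb.
have [ga0E _ gda0 _ da00] := H _ _ ha z0; have [g0bE _ gd0b _ _] := H _ _ z0 hb.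
have [g00E _ gd00 _ _] := H _ _ z0 z0.
have d00 : d 0 0 = 0 by apply: gd00; rewrite g00E !mulr0 addr0.
have [al1|al1] := eqVneq al 0; have [be1|be1] := eqVneq be 0.
- rewrite gd; last by rewrite gE al1 be1 !mul0r addr0.
  by rewrite normr0 mulr_ge0 // al1 be1 invr0 !mulr0 addr0.
- have -> : (L / al + L / be) * g a b = L * b.
    by rewrite gE al1 invr0; field.
  by rewrite gda0 ?subr0 // in db; rewrite ga0E al1 mul0r mulr0 addr0.
- have -> : (L / al + L / be) * g a b = L * a.
    by rewrite gE be1 invr0; field.
  by rewrite gd0b ?subr0 // in da; rewrite g0bE be1 mul0r mulr0 addr0.
- have -> : (L / al + L / be) * g a b =
      L * a + L * b + (L * be / al * b + L * al / be * a).
    by rewrite gE; field; rewrite al1 be1.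
  have /andP[a0 _] := ha; have /andP[b0 _] := hb.
  rewrite -[leLHS]addr0 lerD //; last first.
    by rewrite addr_ge0 ?mulr_ge0 ?invr_ge0.
  rewrite -[X in `|X|](subrK (d a 0)) addrC.
  apply: le_trans (ler_normD _ _) _; rewrite lerD //.
  by rewrite d00 subr0 in da00.
Qed.

(** The six cones, given by their two bounding rays, into which the lines
[u = 0], [v = 0] and [u + v = 0] cut the plane. *)
Definition sectors (R : realType) : seq ((R * R) * (R * R)) :=
  flatten [seq [:: ((sg, 0), (0, sg)); ((sg, 0), (sg, - sg));
                   ((0, sg), (- sg, sg))] | sg <- [:: 1; -1]].

(** The coordinates [a] and [b] are, up to sign, two of [u], [v] and [u + v],
and [u + v] occurs only if [u] and [v] have opposite signs; hence the same bound
[e]. *)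
Lemma sectors_cover (R : realType) (e u v : R) : `|u| <= e -> `|v| <= e ->
  exists2 t, t \in sectors R & exists a b, [/\ 0 <= a <= e, 0 <= b <= e,
    u = a * t.1.1 + b * t.2.1 & v = a * t.1.2 + b * t.2.2].
Proof.
rewrite !ler_norml => /andP[ul ur] /andP[vl vr].
have sectorsP sg t : sg \in [:: 1; -1] ->
    t \in [:: ((sg, 0), (0, sg)); ((sg, 0), (sg, - sg));
              ((0, sg), (- sg, sg))] ->
    t \in sectors R.
  by move=> sgin tin; apply/flatten_mapP; exists sg.
have pos : (1 : R) \in [:: 1; -1] by rewrite inE eqxx.
have neg : (-1 : R) \in [:: 1; -1] by rewrite !inE eqxx orbT.
have /orP[u0|u0] := le_total 0 u; have /orP[v0|v0] := le_total 0 v.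
- exists ((1, 0), (0, 1)); first by apply: sectorsP pos _; rewrite !inE eqxx.
  by exists u, v; split=> /=; [by apply/andP; split; lra.. | |]; ring.
- have /orP[uv|uv] := le_total 0 (u + v).
    exists ((1, 0), (1, -1)).
      by apply: sectorsP pos _; rewrite !inE eqxx !orbT.
    exists (u + v), (- v).
    by split=> /=; [by apply/andP; split; lra.. | |]; ring.
  exists ((0, -1), (1, -1)).
    by apply: sectorsP neg _; rewrite opprK !inE eqxx !orbT.
  by exists (- (u + v)), u; split=> /=; [by apply/andP; split; lra.. | |]; ring.
- have /orP[uv|uv] := le_total 0 (u + v).
    exists ((0, 1), (-1, 1)).
      by apply: sectorsP pos _; rewrite !inE eqxx !orbT.
    exists (u + v), (- u).
    by split=> /=; [by apply/andP; split; lra.. | |]; ring.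
  exists ((-1, 0), (-1, 1)).
    by apply: sectorsP neg _; rewrite opprK !inE eqxx !orbT.
  by exists (- (u + v)), v; split=> /=; [by apply/andP; split; lra.. | |]; ring.
- exists ((-1, 0), (0, -1)); first by apply: sectorsP neg _; rewrite !inE eqxx.
  by exists (- u), (- v); split=> /=; [by apply/andP; split; lra.. | |]; ring.
Qed.

(** On a sector the increments of [x], [y] and [x + y] have constant signs, so
that only one of the two one-sided slopes of [pi] is involved at each point. *)
Lemma defect_sector_linear (R : realType) (pi : R -> R) (x y : R)
    (t : (R * R) * (R * R)) :
  continuous_piecewise_linear pi -> defect pi x y = 0 -> t \in sectors R ->
  exists2 e, 0 < e & exists al be,
    forall a b, 0 <= a <= e -> 0 <= b <= e ->
      defect pi (x + (a * t.1.1 + b * t.2.1)) (y + (a * t.1.2 + b * t.2.2)) =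
      al * a + be * b.
Proof.
move=> plpi; rewrite /defect => xy0 /flatten_mapP[sg sgin tin].
have sg1 : `|sg| = 1.
  by move: sgin; rewrite !inE => /orP[] /eqP ->; rewrite ?normrN normr1.
have sgN : `|- sg| = 1 by rewrite normrN.
have germs s1 s2 s3 : `|s1| = 1 -> `|s2| = 1 -> `|s3| = 1 ->
    exists2 e, 0 < e & exists c1 c2 c3, forall h, 0 <= h <= 2 * e ->
      [/\ pi (x + s1 * h) = pi x + c1 * h, pi (y + s2 * h) = pi y + c2 * h &
          pi (x + y + s3 * h) = pi (x + y) + c3 * h].
  move=> n1 n2 n3; have [e1 e10 [c1 H1]] := linear_germ x plpi n1.
  have [e2 e20 [c2 H2]] := linear_germ y plpi n2.
  have [e3 e30 [c3 H3]] := linear_germ (x + y) plpi n3.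
  exists (Num.min e1 (Num.min e2 e3) / 2).
    by rewrite divr_gt0 // !lt_min e10 e20.
  exists c1, c2, c3 => h; rewrite mulrC divfK // !le_min.
  move=> /and4P[h0 h1 h2 h3].
  by split; [apply: H1 | apply: H2 | apply: H3]; rewrite h0.
move: tin; rewrite !inE => /or3P[] /eqP -> /=.
- have [e e0 [c1 [c2 [c3 H]]]] := germs _ _ _ sg1 sg1 sg1.
  exists e => //; exists (c1 - c3), (c2 - c3).
  move=> a b /andP[a0 ae] /andP[b0 be].
  have -> : a * sg + b * 0 = sg * a by ring.
  have -> : a * 0 + b * sg = sg * b by ring.
  have -> : x + sg * a + (y + sg * b) = x + y + sg * (a + b) by ring.
  have [|-> _ _] := H a; first by apply/andP; split; lra.
  have [|_ -> _] := H b; first by apply/andP; split; lra.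
  have [|_ _ ->] := H (a + b); first by apply/andP; split; lra.
  by lra.
- have [e e0 [c1 [c2 [c3 H]]]] := germs _ _ _ sg1 sgN sg1.
  exists e => //; exists (c1 - c3), (c1 + c2).
  move=> a b /andP[a0 ae] /andP[b0 be].
  have -> : a * sg + b * sg = sg * (a + b) by ring.
  have -> : a * 0 + b * - sg = - sg * b by ring.
  have -> : x + sg * (a + b) + (y + - sg * b) = x + y + sg * a by ring.
  have [|-> _ _] := H (a + b); first by apply/andP; split; lra.
  have [|_ -> _] := H b; first by apply/andP; split; lra.
  have [|_ _ ->] := H a; first by apply/andP; split; lra.
  by lra.
- have [e e0 [c1 [c2 [c3 H]]]] := germs _ _ _ sgN sg1 sg1.
  exists e => //; exists (c2 - c3), (c1 + c2).
  move=> a b /andP[a0 ae] /andP[b0 be].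
  have -> : a * sg + b * sg = sg * (a + b) by ring.
  have -> : a * 0 + b * - sg = - sg * b by ring.
  have -> : x + - sg * b + (y + sg * (a + b)) = x + y + sg * a by ring.
  have [|-> _ _] := H b; first by apply/andP; split; lra.
  have [|_ -> _] := H (a + b); first by apply/andP; split; lra.
  have [|_ _ ->] := H a; first by apply/andP; split; lra.
  by lra.
Qed.

Lemma defect_dominated_near_zero (R : realType) (pi d : R -> R) (K x y : R) :
  continuous_piecewise_linear pi ->
  (forall x y, `|d x - d y| <= K * `|x - y|) ->
  (forall x y, 0 <= defect pi x y) ->
  (forall x y, defect pi x y = 0 -> defect d x y = 0) ->
  defect pi x y = 0 -> defect_dominated_near pi d x y.
Proof.
move=> plpi lipd pos carry xy0.
have K0 : 0 <= K.
  by have := lipd 1 0; rewrite subr0 normr1 mulr1; apply: le_trans.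
pose dominated e C (t : (R * R) * (R * R)) :=
  forall a b, 0 <= a <= e -> 0 <= b <= e ->
  `|defect d (x + (a * t.1.1 + b * t.2.1)) (y + (a * t.1.2 + b * t.2.2))| <=
  C * defect pi (x + (a * t.1.1 + b * t.2.1)) (y + (a * t.1.2 + b * t.2.2)).
have sector t : t \in sectors R ->
    exists2 e, 0 < e & exists2 C, 0 <= C & dominated e C t.
  move=> tin; have [e e0 [al [be lin]]] := defect_sector_linear plpi xy0 tin.
  have [p1 p2 q1 q2] : [/\ `|t.1.1| <= 1, `|t.1.2| <= 1, `|t.2.1| <= 1
      & `|t.2.2| <= 1].
    move: tin; rewrite /sectors /= !inE.
    by move=> /or4P[| | |/or3P[]] /eqP ->; rewrite /= ?normrN ?normr0 ?normr1.
  exists e => //.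
  have L0 : 0 <= 4 * K by rewrite mulr_ge0.
  have step z w p q c : 0 <= c -> `|p| <= 1 -> `|q| <= 1 ->
      `|defect d (z + c * p) (w + c * q) - defect d z w| <= 4 * K * c.
    move=> c0 p1' q1'; apply: le_trans (defect_lipschitz lipd _ _ _ _) _.
    have -> : 4 * K * c = 2 * K * (c + c) by ring.
    rewrite ler_wpM2l ?mulr_ge0 //.
    by rewrite lerD // normrM (ger0_norm c0) ler_piMr.
  apply: (sector_bound e0 L0 (al := al) (be := be)
    (g := fun a b => defect pi (x + (a * t.1.1 + b * t.2.1))
                              (y + (a * t.1.2 + b * t.2.2)))
    (d := fun a b => defect d (x + (a * t.1.1 + b * t.2.1))
                              (y + (a * t.1.2 + b * t.2.2)))).
  move=> a b ha hb; have /andP[a0 _] := ha; have /andP[b0 _] := hb.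
  split; [exact: lin | exact: pos | exact: carry | |].
  - by rewrite !mul0r !addr0 !addrA; exact: step.
  - by rewrite !mul0r !add0r ![a * _ + _]addrC !addrA; exact: step.
have [e e0 [C C0 HC]] : exists2 e, 0 < e & exists2 C, 0 <= C &
    forall t, t \in sectors R -> dominated e C t.
  elim: (sectors R) sector => [|t S IH] sector.
    by exists 1 => //; exists 0.
  have [|e e0 [C C0 H]] := IH.
    by move=> t' t'S; apply: sector; rewrite inE t'S orbT.
  have [e' e'0 [C' C'0 H']] := sector t (mem_head _ _).
  exists (Num.min e e'); first by rewrite lt_min e0.
  exists (C + C') => [|t']; first exact: addr_ge0.
  rewrite inE => t'S a b; rewrite !le_min.
  move=> /and3P[a0 ae ae'] /and3P[b0 be be']; rewrite mulrDl.
  case/orP: t'S => [/eqP ->|t'S].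
    apply: le_trans (H' a b _ _) _; rewrite ?a0 ?b0 //.
    by rewrite lerDr mulr_ge0.
  apply: le_trans (H t' t'S a b _ _) _; rewrite ?a0 ?b0 //.
  by rewrite lerDl mulr_ge0.
exists e => //; exists C => // u v ue ve.
have [t tin [a [b [ha hb -> ->]]]] := sectors_cover ue ve.
exact: HC.
Qed.

(** * Uniform domination *)

(** The bound is monotone in [C], so that the local bounds say that it holds
jointly for pairs near a given one and for [C] near infinity; compactness then
makes it hold on the whole square for all large [C]. *)
Lemma defect_dominated_on_square (R : realType) (pi d : R -> R) :
  (forall x y, 0 <= defect pi x y) ->
  (forall x y, defect_dominated_near pi d x y) ->
  exists2 C, 0 <= C & forall x y, 0 <= x <= 1 -> 0 <= y <= 1 ->
    `|defect d x y| <= C * defect pi x y.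
Proof.
move=> pos near.
have cpt : compact (`[0, 1]%classic `*` `[0, 1]%classic : set (R * R)).
  by apply: compact_setX; exact: segment_compact.
have /compact_near_coveringP/(_ R (+oo)
  (fun C z => `|defect d z.1 z.2| <= C * defect pi z.1 z.2)) := cpt.
case=> [[x y] _|M [_ HM]].
  have [e e0 [C C0 H]] := near x y.
  exists (ball (x, y) e, [set D | C < D]) => /=.
    by split; [exact: nbhsx_ballx | exists C; split => //; exact: num_real].
  move=> [[a b] D] /= [[/= ha hb] CD].
  have := H (a - x) (b - y); rewrite !subrKC => h.
  apply: le_trans (h _ _) _.
  - by rewrite distrC ltW.
  - by rewrite distrC ltW.
  - by rewrite ler_wpM2r // ltW.
exists (Num.max 0 M + 1); first by rewrite addr_ge0 // le_max lexx.
move=> x y hx hy.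
have : M < Num.max 0 M + 1 by rewrite ltr_pwDr // le_max lexx orbT.
by move=> /HM /(_ (x, y)); apply; split; rewrite /= in_itv.
Qed.

Lemma defect_periodic (R : realType) (g : R -> R) (x y k l : R) :
  (forall r k, k \is a Num.int -> g (r + k) = g r) ->
  k \is a Num.int -> l \is a Num.int ->
  defect g (x + k) (y + l) = defect g x y.
Proof.
move=> per kint lint.
by rewrite /defect addrACA (per x) ?(per y) ?(per (x + y)) ?rpredD.
Qed.

Lemma defect_dominated (R : realType) (f : R) (pi pi' : R -> R) :
  continuous_piecewise_linear pi -> minimal_valid f pi ->
  minimal_valid f pi' -> carries_additivity pi pi' ->
  exists2 C, 0 <= C & forall x y,
    `|defect (fun r => pi' r - pi r) x y| <= C * defect pi x y.
Proof.
move=> plpi mpi mpi' add; pose d r := pi' r - pi r.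
have [K1 K10 lip1] := minimal_valid_lipschitz plpi mpi mpi (fun x y => id).
have [K2 K20 lip2] := minimal_valid_lipschitz plpi mpi mpi' add.
have lippi x y : `|pi x - pi y| <= (K1 + K2) * `|x - y|.
  by rewrite mulrDl (le_trans (lip1 _ _)) // lerDl mulr_ge0.
have lipd x y : `|d x - d y| <= (K1 + K2) * `|x - y|.
  have -> : d x - d y = - (pi x - pi y) + (pi' x - pi' y) by rewrite /d; ring.
  by rewrite mulrDl (le_trans (ler_normD _ _)) // normrN lerD.
have pos x y : 0 <= defect pi x y by rewrite subr_ge0 (mv_subadditive mpi).
have carry x y : defect pi x y = 0 -> defect d x y = 0.
  move=> /subr0_eq/esym xy; have := add x y xy; rewrite /defect /d xy => ->.
  by ring.
have [x y|C C0 HC] := @defect_dominated_on_square _ pi d pos.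
  have [xy0|xyn0] := eqVneq (defect pi x y) 0.
    exact: defect_dominated_near_zero plpi lipd pos carry xy0.
  apply: defect_dominated_near_positive lippi lipd _.
  by rewrite lt_def xyn0 pos.
exists C => // x y.
have perd r k : k \is a Num.int -> d (r + k) = d r.
  by move=> kint; rewrite /d (mv_periodic mpi) // (mv_periodic mpi').
(* Both defects are periodic, so that reducing modulo 1 suffices. *)
have fl (z : R) : 0 <= z - (Num.floor z)%:~R <= 1.
  have /andP[] := floor_itv z; rewrite intrD => ? ?.
  by apply/andP; split; lra.
have := HC _ _ (fl x) (fl y).
by rewrite !defect_periodic ?rpredN ?intr_int //; exact: (mv_periodic mpi).
Qed.

(** * Perturbation and conclusion *)

(** Subadditivity survives because [eps] times the perturbing defect is at most
[defect pi].  Nonnegativity follows from it: a negative value of the perturbed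
function [g] at [r] would force [g (n * r) <= n * g r] to tend to minus
infinity, although [g] is bounded below. *)
Lemma perturbation_minimal_valid (R : realType) (f : R) (pi pi' : R -> R)
    (C eps : R) :
  minimal_valid f pi -> minimal_valid f pi' ->
  (forall x y, `|defect (fun r => pi' r - pi r) x y| <= C * defect pi x y) ->
  `|eps| * C <= 1 ->
  minimal_valid f (fun r => pi r + eps * (pi' r - pi r)).
Proof.
move=> mpi mpi' dom epsC; set g := fun r => _.
have sub x y : g (x + y) <= g x + g y.
  have D0 : 0 <= defect pi x y by rewrite subr_ge0 (mv_subadditive mpi).
  have : `|eps * defect (fun r => pi' r - pi r) x y| <= defect pi x y.
    rewrite normrM (le_trans (ler_wpM2l (normr_ge0 _) (dom x y))) //.
    by rewrite mulrA ler_piMl.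
  by rewrite ler_norml /defect /g => /andP[? _]; lra.
have g0 : g 0 = 0 by rewrite /g (mv_0 mpi) (mv_0 mpi'); ring.
have lbd r : - `|eps| <= g r.
  have : `|eps * (pi' r - pi r)| <= `|eps|.
    rewrite normrM ler_piMr // ler_norml.
    have := mv_ge0 mpi r; have := mv_ge0 mpi' r.
    have := minimal_valid_le1 mpi r; have := minimal_valid_le1 mpi' r.
    by move=> *; apply/andP; split; lra.
  by rewrite ler_norml /g => /andP[? _]; have := mv_ge0 mpi r; lra.
split=> //.
- move=> r; rewrite leNgt; apply/negP => gr.
  have mul n : g (n%:R * r) <= n%:R * g r.
    elim: n => [|n IH]; first by rewrite !mul0r g0.
    rewrite -natr1 !mulrDl !mul1r; apply: le_trans (sub _ _) _.
    by rewrite lerD2r.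
  have q0 : 0 <= `|eps| / - g r by rewrite divr_ge0 // oppr_ge0 ltW.
  have /andP[_] := truncn_itv q0; rewrite ltr_pdivrMr ?oppr_gt0 //.
  set n := _.+1; have := mul n; have := lbd (n%:R * r); lra.
- by move=> r k kint; rewrite /g (mv_periodic mpi) // (mv_periodic mpi').
- move=> r; have := mv_symmetric mpi r; have := mv_symmetric mpi' r.
  rewrite /g => h' h.
  have -> : pi' (f - r) = 1 - pi' r by lra.
  have -> : pi (f - r) = 1 - pi r by lra.
  by ring.
Qed.

Lemma extreme_facet (R : realType) (f : R) (pi : R -> R) :
  continuous_piecewise_linear pi -> extreme f pi -> facet f pi.
Proof.
move=> plpi ext; split=> [|pi' vpi' sub]; first exact: ext.1.
have mpi := extreme_minimal_valid ext.
have [mpi' add] := tight_carries mpi vpi' sub.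
have [C C0 dom] := defect_dominated plpi mpi mpi' add.
pose eps := (C + 1)^-1.
have eps0 : 0 < eps by rewrite invr_gt0 ltr_wpDl.
have epsC : `|eps| * C <= 1.
  by rewrite gtr0_norm // mulrC ler_pdivrMr ?ltr_wpDl // mul1r lerDl.
have plus := perturbation_minimal_valid mpi mpi' dom epsC.
rewrite -normrN in epsC.
have minus := perturbation_minimal_valid mpi mpi' dom epsC.
have [] := ext.2 _ _ (minimal_valid_valid plus) (minimal_valid_valid minus).
  by move=> r; field.
move=> piE _; apply/funext => r.
have := congr1 (fun h => h r) piE; rewrite /= -[LHS]addr0 => /addrI/esym/eqP.
by rewrite mulf_eq0 gt_eqF //= subr_eq0 => /eqP.
Qed.

Theorem theorem1p2 (R : realType) (f : R) (hf : f \isn't a Num.int) :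
  [set pi : R -> R | continuous_piecewise_linear pi /\ extreme f pi] =
  [set pi : R -> R | continuous_piecewise_linear pi /\ facet f pi].
Proof.
apply/seteqP; split=> pi /= [plpi h]; split=> //.
  exact: extreme_facet.
exact: facet_extreme.
Qed.
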